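(* Let $h,k,\mu$ be pairwise relatively prime positive integers with $h,k\ge 2$, and for integers $n$ put $\xi_n=e^{2\pi i n/k}$, $\omega_n=e^{2\pi i n/h}$, $\nu_n=e^{2\pi i n/\mu}$. Let $\alpha,\beta$ be positive integers with $(\alpha,h)=(\beta,k)=1$. Then $$h\mu\sum_{j=1}^{k-1}\frac{1}{(\xi_{j+\beta}^{\mu}\omega_\alpha^{\mu}-1)(\xi_j^h-1)}+k\mu\sum_{j=1}^{h-1}\frac{1}{(\xi_\beta^{\mu}\omega_{\alpha+j}^{\mu}-1)(\omega_j^k-1)}+hk\sum_{j=1}^{\mu}\frac{1}{(\omega_\alpha^k\nu_j^k-1)(\xi_\beta^h\nu_j^h-1)}$$ $$=-hk\mu\left(\frac{1}{\omega_\alpha^{k\mu}-1}+\frac{1}{\xi_\beta^{h\mu}-1}\right)+\mu\left(\mu+\frac k2+\frac h2\right)\frac{1}{\xi_\beta^\mu\omega_\alpha^\mu-1}+\frac{\mu^2}{(\xi_\beta^\mu\omega_\alpha^\mu-1)^2}.$$ *)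

(* Defs.v *)
From mathcomp Require Import all_boot all_order all_algebra.
From mathcomp Require Import complex.
From mathcomp Require Import reals sequences exp trigo.

Set Implicit Arguments.
Unset Strict Implicit.
Unset Printing Implicit Defensive.

Import GRing.Theory Num.Theory.
Local Open Scope ring_scope.
Local Open Scope complex_scope.

(* e ^ (a + i b) = e ^ a (cos b + i sin b) *)
Definition cexp (R : realType) (z : R[i]) : R[i] :=
  (expR (complex.Re z))%:C * (cos (complex.Im z) +i* sin (complex.Im z)).

(* e ^ (2 pi i n / m); for m = 0 the division by zero makes it 1. *)
Definition unity_exp (R : realType) (m : nat) (n : int) : R[i] :=
  cexp (2%:R * (pi : R)%:C * 'i * n%:~R / m%:R).

(* Main.v *)
(** Sum the residues of [1 / (z (z^k - 1) (z^h - 1) (c z^mu - 1))] with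
    [c = (xi_beta omega_alpha)^mu].  Since [h], [k], [mu] are pairwise coprime,
    all poles are simple except [z = 1], which is double.  The nontrivial k-th
    and h-th roots of unity give the first two sums, the mu zeros of
    [c z^mu - 1] give the third one, and the residue at 1 gives the terms in
    [1 / (c - 1)].  Algebraically, with [P = X G H Q] where
    [G = (X^k - 1)/(X - 1)], [H = (X^h - 1)/(X - 1)] and [Q = c X^mu - 1],
    the residue theorem is the derivative at 1 of the Lagrange expansion of the
    constant 1 at the (simple) roots of [P]. *)

Require Import Defs.
From mathcomp Require Import all_boot all_order all_algebra.
From mathcomp Require Import complex ring lra.
From mathcomp Require Import reals exp trigo.
Set Implicit Arguments.
Unset Strict Implicit.
Unset Printing Implicit Defensive.
Import Order.TTheory GRing.Theory Num.Theory.
Local Open Scope ring_scope.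

(** * Lagrange interpolation at a full list of simple roots *)

Section SimpleRoots.
Variables (F : fieldType) (p : {poly F}) (s : seq F).
Hypotheses (s_uniq : uniq s) (s_root : all (root p) s).
Hypothesis (size_p : size p = (size s).+1).

Lemma divp_XsubC_root z : z \in s -> p = (p %/ ('X - z%:P)) * ('X - z%:P).
Proof. by move/(allP s_root) => pz; rewrite divpK // dvdp_XsubCl. Qed.

Lemma horner_divp_XsubC z t : z \in s ->
  p.[t] = (p %/ ('X - z%:P)).[t] * (t - z).
Proof. by move/divp_XsubC_root=> {1}->; rewrite hornerM !hornerE. Qed.

Lemma horner_deriv_divp_XsubC z t : z \in s ->
  p^`().[t] = (p %/ ('X - z%:P))^`().[t] * (t - z) + (p %/ ('X - z%:P)).[t].
Proof.
move/divp_XsubC_root=> {1}->.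
by rewrite derivM derivXsubC hornerD !hornerM !hornerE.
Qed.

Lemma size_divp_XsubC_root z : size (p %/ ('X - z%:P)) = size s.
Proof.
by rewrite size_divp ?polyXsubC_eq0 // size_XsubC size_p subn1.
Qed.

(** Otherwise the quotient of [p] by [X - z] would vanish on all of [s]. Its size is [size s], so it
    would be zero, and [p] with it. *)
Lemma deriv_simple_root z : z \in s -> p^`().[z] != 0.
Proof.
move=> zs; rewrite (horner_deriv_divp_XsubC _ zs) subrr mulr0 add0r.
apply/negP => qz0; have q0 : p %/ ('X - z%:P) = 0.
  apply: (roots_geq_poly_eq0 _ s_uniq); last by rewrite size_divp_XsubC_root.
  apply/allP=> y ys; rewrite rootE; have [->//|yz] := eqVneq y z.
  have /eqP := allP s_root _ ys; rewrite (horner_divp_XsubC _ zs).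
  by move/eqP; rewrite mulf_eq0 subr_eq0 (negPf yz) orbF.
by move: size_p; rewrite (divp_XsubC_root zs) q0 mul0r size_poly0.
Qed.

(** The difference of the two sides has size at most [size s], so it is enough to compare values on
    [s], where only one summand survives. *)
Lemma lagrange_one : s != [::] ->
  \sum_(z <- s) (p^`().[z])^-1 *: (p %/ ('X - z%:P)) = 1.
Proof.
move=> s_neq0; apply/eqP; rewrite -subr_eq0; apply/eqP.
apply: (roots_geq_poly_eq0 _ s_uniq).
  apply/allP=> y ys; rewrite rootE hornerD hornerN hornerE horner_sum.
  rewrite (bigD1_seq y) //= big_seq_cond big1 ?addr0.
    move: (deriv_simple_root ys).
    rewrite (horner_deriv_divp_XsubC _ ys) subrr mulr0 add0r hornerZ => qy.
    by rewrite mulVf // subrr.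
  move=> z /andP[zs zy]; rewrite hornerZ.
  have /eqP := allP s_root _ ys; rewrite (horner_divp_XsubC _ zs) => /eqP.
  rewrite mulf_eq0 subr_eq0 (eq_sym y) (negPf zy) orbF => /eqP ->.
  by rewrite mulr0.
rewrite (leq_trans (size_polyD _ _)) // geq_max size_polyN size_poly1.
rewrite lt0n size_eq0 s_neq0 andbT (leq_trans (size_sum _ _ _)) //.
apply/bigmax_leqP_seq => z zs _.
by rewrite (leq_trans (size_scale_leq _ _)) // size_divp_XsubC_root.
Qed.

Lemma sum_inv_simple_roots t : s != [::] -> p.[t] != 0 ->
  \sum_(z <- s) ((t - z) * p^`().[z])^-1 = (p.[t])^-1.
Proof.
move=> s_neq0 pt; have := congr1 (fun q => q.[t]) (lagrange_one s_neq0).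
rewrite /= hornerE horner_sum => E.
apply: (mulfI pt); rewrite mulfV // -E mulr_sumr.
rewrite [RHS]big_seq big_seq; apply: eq_bigr => z zs.
rewrite hornerZ (horner_divp_XsubC _ zs).
have tz : t - z != 0.
  by move: pt; rewrite (horner_divp_XsubC _ zs) mulf_eq0 negb_or => /andP[].
by field; rewrite tz deriv_simple_root.
Qed.

(* The derivative at [t] of the Lagrange expansion of the constant 1. *)
Lemma sum_inv_sqr_simple_roots t : s != [::] -> p.[t] != 0 ->
  \sum_(z <- s) ((z - t) ^+ 2 * p^`().[z])^-1 = p^`().[t] / p.[t] ^+ 2.
Proof.
move=> s_neq0 pt; have := congr1 (fun q => q^`().[t]) (lagrange_one s_neq0).
rewrite /= derivC horner0 raddf_sum horner_sum => E.
(* The quotient rule applied to [p / (X - z)] at [t]. The first half of the sum is then known from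
   [sum_inv_simple_roots]. *)
have {}E : \sum_(z <- s) (p^`().[t] * ((t - z) * p^`().[z])^-1
    - p.[t] * ((z - t) ^+ 2 * p^`().[z])^-1) = 0.
  rewrite -[RHS]E big_seq [RHS]big_seq; apply: eq_bigr => z zs.
  rewrite /= derivZ hornerZ (horner_deriv_divp_XsubC t zs).
  rewrite (horner_divp_XsubC _ zs).
  have tz : t - z != 0.
    by move: pt; rewrite (horner_divp_XsubC _ zs) mulf_eq0 negb_or => /andP[].
  field; rewrite deriv_simple_root // tz /=.
  by rewrite -opprB oppr_eq0 tz.
move: E; rewrite sumrB -!mulr_sumr sum_inv_simple_roots // => /eqP.
rewrite subr_eq0 => /eqP E; apply: (mulfI pt); rewrite -E.
by field.
Qed.

End SimpleRoots.

(** * Powers and sums of roots of unity *)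

Lemma prim_root_expr_neq1 (F : fieldType) n m (z : F) :
  n.-primitive_root z -> (1 < n)%N -> coprime n m -> z ^+ m != 1.
Proof.
move=> prz n_gt1 co_nm; rewrite -(prim_order_dvd prz).
apply: contraL n_gt1 => /coprime_dvdr/(_ co_nm).
by rewrite /coprime gcdnn => /eqP ->.
Qed.

(** Bezout: 1 is a difference of a multiple of [m] and a multiple of [n]. *)
Lemma coprime_unity_root (F : fieldType) m n (z : F) :
  (0 < m)%N -> coprime n m -> z ^+ m = 1 -> z ^+ n = 1 -> z = 1.
Proof.
move=> m_gt0 co_nm zm zn; have [i j E _] := egcdnP n m_gt0.
have := congr1 (fun d => z ^+ d) E; rewrite gcdnC (eqP co_nm) exprD expr1.
by rewrite mulnC exprM zm mulnC exprM zn !expr1n mul1r.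
Qed.

(** The start of the window is left free: exponents are taken from 0 for [w] and [x], but from 1 to
    [mu] for [v]. *)
Lemma prim_root_expr_inj (F : fieldType) n m (z : F) : n.-primitive_root z ->
  {in index_iota m (m + n) &, injective (fun j => z ^+ j)}.
Proof.
move=> prz i j; rewrite !mem_index_iota => /andP[mi i_lt] /andP[mj j_lt] /eqP.
rewrite (eq_prim_root_expr prz) -(subnKC mi) -(subnKC mj) eqn_modDl.
by rewrite !modn_small ?ltn_subLR // => /eqP ->.
Qed.

(** Partial fractions of [1 / (t^m - 1)], with the roots of [X^m - 1] listed as [v^-j]. *)
Lemma sum_inv_prim_root (F : fieldType) m (v t : F) :
  m.-primitive_root v -> t ^+ m != 1 ->
  \sum_(1 <= j < m.+1) (t * v ^+ j - 1)^-1 = m%:R / (t ^+ m - 1).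
Proof.
move=> prv tm; have m_neq0 := prim_root_natf_neq0 prv.
have m_gt0 := prim_order_gt0 prv.
have v0 : v != 0.
  apply/eqP=> v0; have := prim_expr_order prv; rewrite v0 expr0n gtn_eqF //=.
  by move/eqP; rewrite eq_sym oner_eq0.
pose p : {poly F} := 'X^m - 1.
have dp z : p^`().[z] = z ^+ m.-1 *+ m.
  by rewrite derivB derivXn derivC subr0 hornerMn hornerXn.
set s := [seq v ^- j | j <- index_iota 1 m.+1].
have sroot : all (root p) s.
  apply/allP=> _ /mapP[j _ ->]; rewrite rootE !hornerE.
  by rewrite exprVn exprAC (prim_expr_order prv) expr1n invr1 subrr.
have suniq : uniq s.
  rewrite map_inj_in_uniq ?iota_uniq // => i j i_in j_in /invr_inj.
  by apply: (prim_root_expr_inj prv) i_in j_in.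
have sp : size p = (size s).+1.
  by rewrite size_XnsubC // size_map size_iota subn1.
have pt : p.[t] != 0 by rewrite !hornerE subr_eq0.
have := sum_inv_simple_roots suniq sroot sp _ pt.
rewrite -size_eq0 size_map size_iota subn1 -lt0n => /(_ m_gt0).
rewrite big_map !hornerE => E; rewrite -E mulr_sumr.
apply: eq_bigr => j _; rewrite dp.
have vj0 : v ^+ j != 0 by rewrite expf_neq0.
(* This factor of the derivative turns [t - v^-j] into [t v^j - 1]. *)
have -> : (v ^- j) ^+ m.-1 = v ^+ j.
  apply: (mulfI (invr_neq0 vj0)); rewrite -exprS prednK // mulVf //.
  by rewrite exprVn exprAC (prim_expr_order prv) expr1n invr1.
have tv : t * v ^+ j - 1 != 0.
  rewrite subr_eq0; apply: contra tm => /eqP /(congr1 (fun y => y ^+ m)).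
  by rewrite exprMn exprAC (prim_expr_order prv) !expr1n mulr1 => ->.
rewrite -mulr_natr; field.
by rewrite m_neq0 tv vj0.
Qed.


(** * The cofactor of [X - 1] in [X^n - 1] *)

Section GeometricPoly.
Variables (F : fieldType) (n : nat).

(** This is [(X^n - 1) / (X - 1)], given by its coefficients so that its value and derivative at 1
    can be computed directly. *)
Definition geom_poly : {poly F} := \poly_(i < n) 1.

Lemma size_geom_poly : size geom_poly = n.
Proof.
rewrite /geom_poly; case: n => [|m].
  by rewrite poly_def big_ord0 size_poly0.
by rewrite (size_poly_eq (E := fun=> 1)) ?oner_eq0.
Qed.

Lemma mul_XsubC1_geom_poly : ('X - 1%:P) * geom_poly = 'X^n - 1.
Proof.
rewrite subrX1 /geom_poly poly_def; congr (_ * _).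
by apply: eq_bigr => i _; rewrite scale1r.
Qed.

Lemma horner_geom_poly z : (z - 1) * geom_poly.[z] = z ^+ n - 1.
Proof.
have := congr1 (fun q => q.[z]) mul_XsubC1_geom_poly.
by rewrite hornerM !hornerE.
Qed.

Lemma horner_geom_poly1 : geom_poly.[1] = n%:R.
Proof.
rewrite /geom_poly horner_poly -[n in RHS]card_ord -sum1_card natr_sum.
by apply: eq_bigr => i _; rewrite expr1n mulr1.
Qed.

Lemma horner_deriv_geom_poly z :
  geom_poly.[z] + (z - 1) * geom_poly^`().[z] = z ^+ n.-1 *+ n.
Proof.
have := congr1 (fun q => q^`().[z]) mul_XsubC1_geom_poly.
rewrite derivM derivXsubC derivB derivXn derivC subr0 !hornerE.
by rewrite /= hornerMn hornerXn.
Qed.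

(** Differentiating [(X - 1) geom_poly = X^n - 1] at a root leaves [n z^(n-1)] on the right; the
    factor [z] reduces it to [n]. *)
Lemma horner_deriv_geom_poly_root z : (0 < n)%N -> z ^+ n = 1 -> z != 1 ->
  z * (z - 1) * geom_poly^`().[z] = n%:R.
Proof.
move=> n_gt0 zn z1; have := horner_geom_poly z.
rewrite zn subrr => /eqP; rewrite mulf_eq0 subr_eq0 (negPf z1) /= => /eqP g0.
have := horner_deriv_geom_poly z; rewrite g0 add0r -mulrA => ->.
by rewrite -mulr_natr mulrA -exprS prednK // zn mul1r.
Qed.
End GeometricPoly.

(** The sum of the integers below [n], doubled because the field may have characteristic 2. It is
    the source of the halves in the final formula. *)
Lemma horner_deriv_geom_poly1 (F : fieldType) n :
  (geom_poly F n)^`().[1] *+ 2 = n%:R * (n%:R - 1).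
Proof.
rewrite /geom_poly poly_def raddf_sum /= horner_sum.
elim: n => [|n IHn]; first by rewrite big_ord0 mul0rn mul0r.
rewrite big_ord_recr mulrnDl IHn scale1r derivXn hornerMn hornerXn expr1n /=.
by rewrite -natr1 -mulrnA mulnC mulrnA -[1 *+ 2]/(2%:R) -mulr_natr; ring.
Qed.

(** * The residue identity for abstract primitive roots of unity *)

Section Reciprocity.
Variables (F : numFieldType) (h k mu a b : nat) (w x v : F).
Hypotheses (h_ge2 : (2 <= h)%N) (k_ge2 : (2 <= k)%N).
Hypotheses (co_hk : coprime h k) (co_hmu : coprime h mu).
Hypotheses (co_kmu : coprime k mu) (co_ah : coprime a h) (co_bk : coprime b k).
Hypotheses (prw : h.-primitive_root w) (prx : k.-primitive_root x).
Hypothesis (prv : mu.-primitive_root v).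

Let c := (x ^+ b * w ^+ a) ^+ mu.
Let A := w ^+ a.
Let B := x ^+ b.

Let A_h : A ^+ h = 1.
Proof. by rewrite exprAC (prim_expr_order prw) expr1n. Qed.

Let B_k : B ^+ k = 1.
Proof. by rewrite exprAC (prim_expr_order prx) expr1n. Qed.

(** The exponent [a k mu] of [w] is coprime to the order [h]. *)
Let A_neq1 : A ^+ (k * mu) != 1.
Proof.
rewrite -exprM (prim_root_expr_neq1 prw) // !coprimeMr co_hk co_hmu.
by rewrite coprime_sym co_ah.
Qed.

Let B_neq1 : B ^+ (h * mu) != 1.
Proof.
rewrite -exprM (prim_root_expr_neq1 prx) // !coprimeMr co_kmu.
by rewrite coprime_sym co_bk coprime_sym co_hk.
Qed.

Let k_gt0 : (0 < k)%N. Proof. exact: ltnW. Qed.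
Let h_gt0 : (0 < h)%N. Proof. exact: ltnW. Qed.
Let mu_gt0 : (0 < mu)%N. Proof. exact: prim_order_gt0 prv. Qed.

Let BA_neq0 : B * A != 0.
Proof.
apply/negP => /eqP E; have := A_neq1; have := congr1 (fun y => y ^+ (h * k)) E.
rewrite exprMn mulnC exprM B_k expr1n mulnC exprM A_h expr1n mulr1 expr0n.
by rewrite gtn_eqF ?muln_gt0 ?h_gt0 //= => /eqP; rewrite oner_eq0.
Qed.

Let v_neq0 : v != 0.
Proof.
apply/eqP => v0; have := prim_expr_order prv; rewrite v0 expr0n gtn_eqF //=.
by move/eqP; rewrite eq_sym oner_eq0.
Qed.

(** The [k]-th power of [c z^mu = 1] eliminates [B] and [z] and leaves [A^(k mu) = 1]. The case
    [z = 1] gives [c != 1]. *)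
Let Q_neq0_k z : z ^+ k = 1 -> c * z ^+ mu - 1 != 0.
Proof.
move=> zk; rewrite subr_eq0; apply: contra A_neq1 => /eqP.
move/(congr1 (fun y => y ^+ k)); rewrite expr1n /c -exprMn exprAC.
have -> : (B * A * z) ^+ k = A ^+ k by rewrite !exprMn zk B_k mul1r mulr1.
by rewrite -exprM => ->.
Qed.

Let Q_neq0_h z : z ^+ h = 1 -> c * z ^+ mu - 1 != 0.
Proof.
move=> zh; rewrite subr_eq0; apply: contra B_neq1 => /eqP.
move/(congr1 (fun y => y ^+ h)); rewrite expr1n /c -exprMn exprAC.
have -> : (B * A * z) ^+ h = B ^+ h by rewrite !exprMn zh A_h !mulr1.
by rewrite -exprM => ->.
Qed.

Let c_neq1 : c - 1 != 0.
Proof. by have := Q_neq0_k (expr1n _ k); rewrite expr1n mulr1. Qed.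

Let c_neq0 : c != 0.
Proof. by rewrite expf_neq0. Qed.

Let G := geom_poly F k.
Let H := geom_poly F h.
Let Q : {poly F} := c *: 'X^mu - 1%:P.
Let P : {poly F} := 'X * G * H * Q.

Let Q_ z : Q.[z] = c * z ^+ mu - 1.
Proof. by rewrite !hornerE. Qed.

Let dQ_ z : Q^`().[z] = c * (z ^+ mu.-1 *+ mu).
Proof.
by rewrite derivB derivZ derivXn derivC subr0 hornerZ hornerMn hornerXn.
Qed.

(** At each root of [P] only the term that differentiates the vanishing factor survives. *)
Let dP_ z : P^`().[z] = G.[z] * H.[z] * Q.[z] + z * G^`().[z] * H.[z] * Q.[z]
  + z * G.[z] * H^`().[z] * Q.[z] + z * G.[z] * H.[z] * Q^`().[z].
Proof. by rewrite !derivM derivX !(hornerD, hornerM, hornerE); ring. Qed.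

Let size_Q : size Q = mu.+1.
Proof.
rewrite size_polyDl size_scale ?size_polyXn //.
by rewrite size_polyN (leq_ltn_trans (size_polyC_leq1 _)).
Qed.

Let size_P : size P = (k + h + mu)%N.
Proof.
have nz (p : {poly F}) : (0 < size p)%N -> p != 0 by rewrite lt0n size_poly_eq0.
have [G0 H0 Q0] : [/\ G != 0, H != 0 & Q != 0].
  by split; apply: nz; rewrite ?size_geom_poly ?size_Q.
rewrite !size_mul ?mulf_neq0 ?polyX_eq0 // size_polyX !size_geom_poly size_Q.
by case: k k_gt0 h h_gt0 => [|k'] // _ [|h'] // _; rewrite /= !addnS !addSn.
Qed.

Let xs := [seq x ^+ j | j <- index_iota 1 k].
Let ws := [seq w ^+ j | j <- index_iota 1 h].
(** The zeros of [Q], since [c = (B A)^mu]. With [v^-j] instead of [v^j], the powers [z^k] and [z^h]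
    are the inverses of the products in the third sum. *)
Let vs := [seq (B * A)^-1 * v ^- j | j <- index_iota 1 mu.+1].
Let s := 0 :: xs ++ ws ++ vs.

Let size_s : size P = (size s).+1.
Proof.
rewrite size_P /= !size_cat !size_map !size_iota !subn1 /=.
case: k k_gt0 h h_gt0 => [|k'] // _ [|h'] // _.
by rewrite /= !addSn !addnS addSn addnA.
Qed.

Let xsP z : z \in xs -> z ^+ k = 1 /\ z != 1.
Proof.
case/mapP => j; rewrite mem_index_iota => /andP[j0 jk] ->.
rewrite exprAC (prim_expr_order prx) expr1n; split=> //.
by rewrite -(prim_order_dvd prx) gtnNdvd.
Qed.

Let wsP z : z \in ws -> z ^+ h = 1 /\ z != 1.
Proof.
case/mapP => j; rewrite mem_index_iota => /andP[j0 jk] ->.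
rewrite exprAC (prim_expr_order prw) expr1n; split=> //.
by rewrite -(prim_order_dvd prw) gtnNdvd.
Qed.

Let vsP z : z \in vs -> c * z ^+ mu = 1.
Proof.
case/mapP => j _ ->; rewrite /c -exprMn mulrA mulfV // mul1r exprVn exprAC.
by rewrite (prim_expr_order prv) expr1n invr1.
Qed.

Let G_ z : z \in xs -> G.[z] = 0.
Proof.
case/xsP => zk z1; have /eqP := horner_geom_poly k z.
by rewrite zk subrr mulf_eq0 subr_eq0 (negPf z1) => /eqP.
Qed.

Let H_ z : z \in ws -> H.[z] = 0.
Proof.
case/wsP => zk z1; have /eqP := horner_geom_poly h z.
by rewrite zk subrr mulf_eq0 subr_eq0 (negPf z1) => /eqP.
Qed.

Let s_root : all (root P) s.
Proof.
apply/allP => z; rewrite rootE !hornerM hornerX inE !mem_cat.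
case/orP => [/eqP ->|/or3P[/G_ ->|/H_ ->|/vsP Qz]]; rewrite ?(mulr0, mul0r) //.
by rewrite Q_ Qz subrr mulr0.
Qed.

(** 0 is no root of unity and no zero of [Q]; a common [k]-th and [h]-th root of unity is 1, which
    both lists omit; zeros of [Q] are neither kind of root of unity. *)
Let s_uniq : uniq s.
Proof.
rewrite /= !mem_cat !cat_uniq !map_inj_in_uniq ?iota_uniq /=.
- rewrite !negb_or -!andbA; apply/and5P; split.
  + by apply/negP => /xsP[/eqP]; rewrite expr0n gtn_eqF // eq_sym oner_eq0.
  + by apply/negP => /wsP[/eqP]; rewrite expr0n gtn_eqF // eq_sym oner_eq0.
  + by apply/negP => /vsP/eqP; rewrite expr0n gtn_eqF // mulr0 eq_sym oner_eq0.
  + apply/hasPn => z; rewrite mem_cat => /orP[/wsP[zh z1]|/vsP zv].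
      apply: contra z1 => /xsP[zk _].
      by rewrite (coprime_unity_root k_gt0 co_hk zk zh).
    by apply/negP => /xsP[/Q_neq0_k]; rewrite zv subrr eqxx.
  + rewrite andbT; apply/hasPn => z /vsP zv.
    by apply/negP => /wsP[/Q_neq0_h]; rewrite zv subrr eqxx.
- move=> i j i_in j_in /(mulfI (invr_neq0 BA_neq0))/invr_inj.
  by apply: (@prim_root_expr_inj _ _ 1%N _ prv).
- move=> i j; rewrite !mem_index_iota => /andP[_ ik] /andP[_ jk].
  by apply: (@prim_root_expr_inj _ _ 0%N _ prw); rewrite mem_index_iota.
- move=> i j; rewrite !mem_index_iota => /andP[_ ik] /andP[_ jk].
  by apply: (@prim_root_expr_inj _ _ 0%N _ prx); rewrite mem_index_iota.
Qed.

Let P1 : P.[1] = k%:R * h%:R * (c - 1).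
Proof.
by rewrite !hornerM hornerX mul1r !horner_geom_poly1 Q_ expr1n mulr1.
Qed.

Let P1_neq0 : P.[1] != 0.
Proof. by rewrite P1 !mulf_neq0 // pnatr_eq0 -lt0n. Qed.

Let k_neq0 : k%:R != 0 :> F. Proof. by rewrite pnatr_eq0 -lt0n. Qed.
Let h_neq0 : h%:R != 0 :> F. Proof. by rewrite pnatr_eq0 -lt0n. Qed.
Let mu_neq0 : mu%:R != 0 :> F. Proof. by rewrite pnatr_eq0 -lt0n. Qed.

(** The logarithmic derivative at 1 is [1 + (k-1)/2 + (h-1)/2 + c mu / (c-1)]; it is divided once
    more by [P(1)]. *)
Let dP1 : P^`().[1] / P.[1] ^+ 2 =
  (k%:R + h%:R) / 2 / (k%:R * h%:R * (c - 1))
   + c * mu%:R / (k%:R * h%:R * (c - 1) ^+ 2).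
Proof.
rewrite P1 dP_ !horner_geom_poly1 Q_ dQ_ !expr1n mulr1 !mul1r.
have dg n : (geom_poly F n)^`().[1] = n%:R * (n%:R - 1) / 2.
  by rewrite -horner_deriv_geom_poly1 -[_ *+ 2]mulr_natr mulfK ?pnatr_eq0.
by rewrite !dg; field; rewrite c_neq1 h_neq0 k_neq0.
Qed.

(** The residue at 0. It later cancels the constant [mu] of [sum_vsE] after division by [mu]. *)
Let sum0 : ((0 - 1) ^+ 2 * P^`().[0])^-1 = -1 :> F.
Proof.
have g0 n : (0 < n)%N -> (geom_poly F n).[0] = 1.
  move=> n_gt0; have := horner_geom_poly n (0 : F).
  by rewrite expr0n gtn_eqF //= !sub0r mulN1r => /oppr_inj.
rewrite dP_ !g0 // Q_ expr0n gtn_eqF //= !(mul0r, mulr0, addr0, sub0r, mul1r).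
by rewrite sqrrN expr1n mul1r invrN invr1.
Qed.

(** One factor [z - 1] joins [z G'(z)] to give [k], the other joins [H(z)] to give [z^h - 1]. *)
Let sum_xs z : z \in xs -> ((z - 1) ^+ 2 * P^`().[z])^-1 =
  k%:R^-1 * (1 / ((c * z ^+ mu - 1) * (z ^+ h - 1))).
Proof.
move=> zx; have [zk z1] := xsP zx.
rewrite dP_ (G_ zx) !(mulr0, mul0r, addr0) add0r.
rewrite -(horner_deriv_geom_poly_root k_gt0 zk z1) -(horner_geom_poly h) Q_.
by rewrite mul1r -invfM; congr (_^-1); rewrite -/G -/H; ring.
Qed.

Let sum_ws z : z \in ws -> ((z - 1) ^+ 2 * P^`().[z])^-1 =
  h%:R^-1 * (1 / ((c * z ^+ mu - 1) * (z ^+ k - 1))).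
Proof.
move=> zx; have [zk z1] := wsP zx.
rewrite dP_ (H_ zx) !(mulr0, mul0r, addr0) !add0r.
rewrite -(horner_deriv_geom_poly_root h_gt0 zk z1) -(horner_geom_poly k) Q_.
by rewrite mul1r -invfM; congr (_^-1); rewrite -/G -/H; ring.
Qed.

Let sum_vs z : z \in vs -> ((z - 1) ^+ 2 * P^`().[z])^-1 =
  mu%:R^-1 * (1 / ((z ^+ k - 1) * (z ^+ h - 1))).
Proof.
move=> zv; have cz := vsP zv.
rewrite dP_ Q_ cz subrr !(mulr0, mul0r, addr0) !add0r.
rewrite -(horner_geom_poly k) -(horner_geom_poly h) dQ_.
(* Both factors [z - 1] are absorbed by [G] and [H], and [z Q'(z) = mu c z^mu = mu] at a zero of
   [Q]. *)
have -> : mu%:R = z * (c * (z ^+ mu.-1 *+ mu)) :> F.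
  by rewrite -[_ ^+ _ *+ mu]mulr_natr mulrCA [z * _]mulrA -exprS
    prednK // mulrA cz mul1r.
by rewrite mul1r -invfM; congr (_^-1); rewrite -/G -/H; ring.
Qed.

Let sum_all :
  -1 + (k%:R^-1 * (\sum_(z <- xs) 1 / ((c * z ^+ mu - 1) * (z ^+ h - 1)))
   + (h%:R^-1 * (\sum_(z <- ws) 1 / ((c * z ^+ mu - 1) * (z ^+ k - 1)))
   + mu%:R^-1 * (\sum_(z <- vs) 1 / ((z ^+ k - 1) * (z ^+ h - 1)))))
  = (k%:R + h%:R) / 2 / (k%:R * h%:R * (c - 1))
   + c * mu%:R / (k%:R * h%:R * (c - 1) ^+ 2).
Proof.
rewrite -dP1 -(sum_inv_sqr_simple_roots s_uniq s_root size_s) //.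
rewrite /s big_cons !big_cat /= sum0 !mulr_sumr.
congr (_ + (_ + (_ + _))); rewrite big_seq [RHS]big_seq; apply: eq_bigr => z.
- by move/sum_xs ->.
- by move/sum_ws ->.
- by move/sum_vs ->.
Qed.

(* [1/(1/y - 1) = - 1 - 1/(y - 1)] turns the residues at the zeros of [Q]
   into the summands of the statement. *)
Let sum_vsE : \sum_(z <- vs) 1 / ((z ^+ k - 1) * (z ^+ h - 1)) =
  mu%:R + mu%:R / (A ^+ (k * mu) - 1) + mu%:R / (B ^+ (h * mu) - 1) +
  \sum_(1 <= j < mu.+1)
    1 / ((A ^+ k * (v ^+ j) ^+ k - 1) * (B ^+ h * (v ^+ j) ^+ h - 1)).
Proof.
(* As [k] and [h] are coprime to [mu], these powers stay primitive, so [sum_inv_prim_root] evaluates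
   the two single sums. *)
have prvk : mu.-primitive_root (v ^+ k).
  by rewrite (prim_root_exp_coprime _ prv).
have prvh : mu.-primitive_root (v ^+ h).
  by rewrite (prim_root_exp_coprime _ prv).
rewrite ![_ ^+ (_ * mu)]exprM.
have Ak : (A ^+ k) ^+ mu != 1 by rewrite -exprM.
have Bh : (B ^+ h) ^+ mu != 1 by rewrite -exprM.
rewrite -(sum_inv_prim_root prvk) // -(sum_inv_prim_root prvh) //.
(* Writing [mu] as a sum of ones makes the comparison termwise. *)
have -> : mu%:R = \sum_(1 <= j < mu.+1) 1 :> F.
  by rewrite big_const_nat iter_addr_0 subn1.
rewrite -!big_split big_map /=; apply: eq_bigr => j _.
have nz m (y : F) : y ^+ mu != 1 -> y * (v ^+ j) ^+ m - 1 != 0.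
  move=> ymu; rewrite subr_eq0; apply: contra ymu => /eqP.
  move/(congr1 (fun y => y ^+ mu)).
  rewrite exprMn -!exprM mulnC exprM (prim_expr_order prv).
  by rewrite !expr1n mulr1 => ->.
have := nz k _ Ak; have := nz h _ Bh.
have vj0 : v ^+ j != 0 by rewrite expf_neq0.
have E : ((B * A)^-1 * v ^- j) ^+ k = (A ^+ k * (v ^+ j) ^+ k)^-1.
  by rewrite exprMn !exprVn exprMn B_k mul1r invfM.
have E' : ((B * A)^-1 * v ^- j) ^+ h = (B ^+ h * (v ^+ j) ^+ h)^-1.
  by rewrite exprMn !exprVn exprMn A_h mulr1 invfM.
rewrite E E' -!exprM ![(_ * j)%N]mulnC !exprM.
have /andP[B0 A0] : (B != 0) && (A != 0) by rewrite -negb_or -mulf_eq0.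
have : A ^+ k * (v ^+ j) ^+ k != 0.
  exact: mulf_neq0 (expf_neq0 k A0) (expf_neq0 k vj0).
have : B ^+ h * (v ^+ j) ^+ h != 0.
  exact: mulf_neq0 (expf_neq0 h B0) (expf_neq0 h vj0).
set y := A ^+ k * _; set y' := B ^+ h * _ => y'0 y0 y'1 y1.
have y1' : 1 - y != 0 by rewrite subr_eq0 eq_sym -subr_eq0.
have y'1' : 1 - y' != 0 by rewrite subr_eq0 eq_sym -subr_eq0.
by field; rewrite !mulN1r y0 y'0 y1 y'1 y1' y'1'.
Qed.

Theorem root_of_unity_reciprocity :
  h%:R * mu%:R *
    (\sum_(1 <= j < k)
      1 / (((x ^+ (j + b)) ^+ mu * (w ^+ a) ^+ mu - 1) * ((x ^+ j) ^+ h - 1)))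
  + k%:R * mu%:R *
    (\sum_(1 <= j < h)
      1 / (((x ^+ b) ^+ mu * (w ^+ (a + j)) ^+ mu - 1) * ((w ^+ j) ^+ k - 1)))
  + h%:R * k%:R *
    (\sum_(1 <= j < mu.+1)
      1 / (((w ^+ a) ^+ k * (v ^+ j) ^+ k - 1)
           * ((x ^+ b) ^+ h * (v ^+ j) ^+ h - 1)))
  = - (h%:R * k%:R * mu%:R) *
      (1 / ((w ^+ a) ^+ (k * mu) - 1) + 1 / ((x ^+ b) ^+ (h * mu) - 1))
    + mu%:R * (mu%:R + k%:R / 2%:R + h%:R / 2%:R) *
      (1 / ((x ^+ b) ^+ mu * (w ^+ a) ^+ mu - 1))
    + mu%:R ^+ 2 / ((x ^+ b) ^+ mu * (w ^+ a) ^+ mu - 1) ^+ 2.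
Proof.
have := sum_all; rewrite sum_vsE !big_map.
have -> : \sum_(1 <= j < k)
    1 / (((x ^+ (j + b)) ^+ mu * (w ^+ a) ^+ mu - 1) * ((x ^+ j) ^+ h - 1)) =
  \sum_(1 <= j < k) 1 / ((c * (x ^+ j) ^+ mu - 1) * ((x ^+ j) ^+ h - 1)).
  apply: eq_bigr => j _.
  by rewrite exprD /c !exprMn -mulrA [(x ^+ j) ^+ mu * _]mulrC.
have -> : \sum_(1 <= j < h)
    1 / (((x ^+ b) ^+ mu * (w ^+ (a + j)) ^+ mu - 1) * ((w ^+ j) ^+ k - 1)) =
  \sum_(1 <= j < h) 1 / ((c * (w ^+ j) ^+ mu - 1) * ((w ^+ j) ^+ k - 1)).
  by apply: eq_bigr => j _; rewrite exprD /c !exprMn mulrA.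
rewrite -exprMn -/c -/A -/B.
move: A_neq1 B_neq1; rewrite -!(subr_eq0 _ 1).
move: (A ^+ _ - 1) (B ^+ _ - 1) => d e d0 e0.
set S1 := \sum_(1 <= j < k) _; set S2 := \sum_(1 <= j < h) _.
set S3 := \sum_(1 <= j < mu.+1) _ => E.
(* This clears the coefficients [1/k], [1/h] and [1/mu] of the three sums. *)
have := congr1 (fun y => h%:R * k%:R * mu%:R * y) E => {}E.
apply: (addIr (h%:R * k%:R * mu%:R * (d^-1 + e^-1))).
transitivity (h%:R * k%:R * mu%:R * (-1 + (k%:R^-1 * S1 + (h%:R^-1 * S2 +
   mu%:R^-1 * (mu%:R + mu%:R / d + mu%:R / e + S3)))) : F).
  by field; rewrite h_neq0 k_neq0 mu_neq0 d0 e0.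
(* Here [c = (c - 1) + 1] splits [mu^2 c / (c-1)^2] into the two terms in [mu^2] of the
   statement. *)
by rewrite E; field; rewrite h_neq0 k_neq0 c_neq1 d0 e0.
Qed.

End Reciprocity.

(** * Complex exponentials as primitive roots of unity *)

Lemma unity_expE (R : realType) m (n : nat) :
  unity_exp R m n%:Z =
  (cos (pi *+ 2 * n%:R / m%:R) +i* sin (pi *+ 2 * n%:R / m%:R))%C.
Proof.
rewrite /unity_exp /cexp.
have -> : 2%:R * (pi : R)%:C%C * 'i%C * n%:Z%:~R / m%:R =
    (0 +i* (pi *+ 2 * n%:R / m%:R))%C.
  rewrite -[n%:Z%:~R]/(n%:R) -!(rmorph_nat (real_complex R)) -fmorphV.
  apply/eqP; rewrite eq_complex /= -mulr_natr.
  by apply/andP; split; apply/eqP; ring.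
by rewrite /= expR0 mul1r.
Qed.

Lemma unity_expD (R : realType) m (i j : nat) :
  unity_exp R m (i%:Z + j%:Z) = unity_exp R m i%:Z * unity_exp R m j%:Z.
Proof.
rewrite -PoszD !unity_expE natrD mulrDr mulrDl /= cosD sinD.
by apply/eqP; rewrite eq_complex /= eqxx addrC eqxx.
Qed.

Lemma unity_exp0 (R : realType) m : unity_exp R m 0%:Z = 1.
Proof. by rewrite unity_expE mulr0 mul0r /= cos0 sin0. Qed.

Lemma unity_exp_expr (R : realType) m (n : nat) :
  unity_exp R m n%:Z = unity_exp R m 1%:Z ^+ n.
Proof.
elim: n => [|n IHn]; first by rewrite unity_exp0.
by rewrite exprS -IHn -unity_expD -PoszD.
Qed.

(** Half angle: [t = pi n / m] lies strictly between 0 and [pi], so [sin t > 0] and the real part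
    [1 - 2 sin^2 t] is below 1. *)
Lemma unity_exp_neq1 (R : realType) m (n : nat) :
  (0 < n < m)%N -> unity_exp R m n%:Z != 1.
Proof.
case/andP=> n_gt0 n_lt; have m_gt0 : (0 < m)%N := leq_ltn_trans (leq0n n) n_lt.
have : 0 < sin (pi * n%:R / m%:R) :> R.
  apply: sin_gt0_pi; rewrite divr_gt0 ?mulr_gt0 ?pi_gt0 ?ltr0n //=.
  by rewrite ltr_pdivrMr ?ltr0n // ltr_pM2l ?pi_gt0 // ltr_nat.
have double (p : R) : p *+ 2 * n%:R / m%:R = (p * n%:R / m%:R) *+ 2.
  by rewrite 2!mulrnAl.
rewrite unity_expE double.
move: (pi * n%:R / m%:R) => t sin_t.
rewrite eq_complex negb_and /= cos_mulr2n cos2sin2; apply/orP; left.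
by apply/eqP => E; have := exprn_gt0 2 sin_t; lra.
Qed.

Lemma unity_exp_prim (R : realType) m : (0 < m)%N ->
  m.-primitive_root (unity_exp R m 1%:Z).
Proof.
move=> m_gt0; apply/andP; split=> //; apply/forallP => i.
rewrite unity_rootE -unity_exp_expr.
have [->|i_neq] := eqVneq i.+1 m.
  rewrite unity_expE -mulrA mulfV ?pnatr_eq0 -?lt0n // mulr1 /= cos2pi sin2pi.
  by rewrite eqxx.
by rewrite (negPf (unity_exp_neq1 _ _)) //= ltn_neqAle i_neq ltn_ord.
Qed.

Lemma unity_exp_spec (R : realType) m : (0 < m)%N ->
  exists2 z : R[i], m.-primitive_root z &
    forall n : nat, unity_exp R m n%:Z = z ^+ n.
Proof.
move=> m_gt0; exists (unity_exp R m 1%:Z); first exact: unity_exp_prim.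
exact: unity_exp_expr.
Qed.

Local Open Scope complex_scope.

Theorem mainTheorem10 (R : realType) (h k mu alpha beta : nat)
  (h_ge2 : (2 <= h)%N) (k_ge2 : (2 <= k)%N) (mu_gt0 : (0 < mu)%N)
  (co_hk : coprime h k) (co_hmu : coprime h mu) (co_kmu : coprime k mu)
  (alpha_gt0 : (0 < alpha)%N) (beta_gt0 : (0 < beta)%N)
  (co_alphah : coprime alpha h) (co_betak : coprime beta k) :
  let xi (n : int) : R[i] := unity_exp R k n in
  let omega (n : int) : R[i] := unity_exp R h n in
  let nu (n : int) : R[i] := unity_exp R mu n in
  h%:R * mu%:R *
    (\sum_(1 <= j < k)
      1 / ((xi (j%:Z + beta%:Z) ^+ mu * omega alpha%:Z ^+ mu - 1)
           * (xi j%:Z ^+ h - 1)))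
  + k%:R * mu%:R *
    (\sum_(1 <= j < h)
      1 / ((xi beta%:Z ^+ mu * omega (alpha%:Z + j%:Z) ^+ mu - 1)
           * (omega j%:Z ^+ k - 1)))
  + h%:R * k%:R *
    (\sum_(1 <= j < mu.+1)
      1 / ((omega alpha%:Z ^+ k * nu j%:Z ^+ k - 1)
           * (xi beta%:Z ^+ h * nu j%:Z ^+ h - 1)))
  = - (h%:R * k%:R * mu%:R) *
      (1 / (omega alpha%:Z ^+ (k * mu) - 1)
       + 1 / (xi beta%:Z ^+ (h * mu) - 1))
    + mu%:R * (mu%:R + k%:R / 2%:R + h%:R / 2%:R) *
      (1 / (xi beta%:Z ^+ mu * omega alpha%:Z ^+ mu - 1))
    + mu%:R ^+ 2 / (xi beta%:Z ^+ mu * omega alpha%:Z ^+ mu - 1) ^+ 2.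
Proof.
move=> xi omega nu.
have [x prx xiE] := unity_exp_spec R (ltnW k_ge2).
have [w prw omegaE] := unity_exp_spec R (ltnW h_ge2).
have [v prv nuE] := unity_exp_spec R mu_gt0.
have {}xiE (n : nat) : xi n%:Z = x ^+ n := xiE n.
have {}omegaE (n : nat) : omega n%:Z = w ^+ n := omegaE n.
have {}nuE (n : nat) : nu n%:Z = v ^+ n := nuE n.
clearbody xi omega nu.
have xiD (i j : nat) : xi (i%:Z + j%:Z) = x ^+ (i + j) by rewrite -PoszD xiE.
have omegaD (i j : nat) : omega (i%:Z + j%:Z) = w ^+ (i + j).
  by rewrite -PoszD omegaE.
have := root_of_unity_reciprocity h_ge2 k_ge2 co_hk co_hmu co_kmu co_alphah
  co_betak prw prx prv.
(* The right-hand sides now agree; only the summands on the left remain to be rewritten as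
   powers. *)
rewrite xiE omegaE => /(etrans _); apply.
under eq_bigr do rewrite xiD xiE.
under [X in _ + _ * X + _]eq_bigr do rewrite omegaD omegaE.
by under [X in _ + _ * X = _]eq_bigr do rewrite nuE.
Qed.
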